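(* Let $A:\mathcal{D}^*\to\mathbb{C}^m$ be a weak-* continuous linear map which has the RIP on $\mathcal{S}(\Sigma)$ with respect to $\|\cdot\|_{\mathcal H}$ with constant $\gamma\ge 0$. Let $\phi:\mathbb{R}^d\to\mathcal{D}^*$ be a parametrization of the cone $\Sigma$ that is weak-* continuous and twice weak-* Gateaux differentiable, with $\Theta=\phi^{-1}(\Sigma)$ open. Suppose that $\|\cdot\|_{\mathcal H}$ satisfies the compatibility assumption (see context). Let $y=Ax_0+e$ with $x_0\in\Sigma$, $e\in\mathbb{C}^m$, let $g(\theta)=\|A\phi(\theta)-y\|_2^2$, and let $\theta^*$ be a global minimizer of $g$ on $\Theta$. Assume that there exists $\beta>0$ such that: 1. the technical assumption (see context) on $\phi$ and on the radius $\beta$ is fulfilled with constants $C_{\phi,\theta^*}$, $M_1$, $M_2$; 2. for any $\theta\in\Lambda_\beta$ there exists $\tilde\theta\in p(\theta,\theta^* )$ such that $$\forall z\in[\theta,\tilde\theta],\qquad \frac{(1-\gamma)\,\|\partial_{\tilde\theta-\theta}\phi(z)\|_{\mathcal H}^2}{\sqrt{1+\gamma}\,\|A\partial^2_{\tilde\theta-\theta}\phi(z)\|_2}\;\ge\; C_{\phi,\theta^*}\,\beta+\frac{1}{\sqrt{1+\gamma}}\|e\|_2,$$ where the quotient is read as $+\infty$ when its denominator vanishes. Then $\Lambda_\beta$ is a $g$-basin of attraction of $\theta^*$.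
   Context: Setting. $\mathcal{D}$ is a Banach space, $\mathcal{D}^*$ its dual with the weak-* topology, $\langle\cdot,\cdot\rangle$ the duality product; $A$ has the form $(Ax)_l=\langle x,\alpha_l\rangle$ with $\alpha_l\in\mathcal{D}$, $1\le l\le m$. $\Sigma\subset\mathcal{D}^*$ is a cone ($\lambda x\in\Sigma$ for $x\in\Sigma,\lambda>0$), contained in a Hilbert space $(\mathcal H,\|\cdot\|_{\mathcal H})$ whose vector operations agree with those of $\mathcal{D}^*$ on $\Sigma$. A parametrization of $\Sigma$ is a map $\phi:\mathbb{R}^d\to\mathcal{D}^*$ with $\Sigma\subset\phi(\mathbb{R}^d)$; $\Theta:=\phi^{-1}(\Sigma)$. Weak-* Gateaux differentiability. $\phi$ is weak-* Gateaux differentiable at $\theta$ if there is a linear map $L_\theta:\mathbb{R}^d\to\mathcal{D}^*$ with $(\phi(\theta+hu)-\phi(\theta))/h\to L_\theta u$ weakly-* as $h\to0$, for every $u\in\mathbb{R}^d$; write $\partial_u\phi(\theta)=L_\theta u$. $\phi$ is twice weak-* Gateaux differentiable if it is weak-* Gateaux differentiable and, for every $u$, $\partial_u\phi$ is weak-* Gateaux differentiable; $\partial_u^2\phi=\partial_u\partial_u\phi$. Secants and RIP. $\mathcal{S}(\Sigma)=\Sigma-\Sigma$. The generalized secant set $\overline{\mathcal{S}(\Sigma)}$ consists of all elements of $\mathcal{S}(\Sigma)$ and all $\partial_u\phi(\theta)$ with $\phi(\theta)\in\Sigma$, $u\in\mathbb{R}^d$. $A$ has the RIP on $\mathcal{S}(\Sigma)$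 with constant $\gamma$ if $(1-\gamma)\|x\|_{\mathcal H}^2\le\|Ax\|_2^2\le(1+\gamma)\|x\|_{\mathcal H}^2$ for all $x\in\mathcal{S}(\Sigma)$. Compatibility assumption. For every $\partial_u\phi(\theta)\in\overline{\mathcal{S}(\Sigma)}$ with $\phi(\theta)\in\Sigma$, $\left\|\frac{\phi(\theta+|h_n|u)-\phi(\theta)}{|h_n|}\right\|_{\mathcal H}$ converges for every real sequence $|h_n|\to0$ to a limit not depending on the sequence; this limit is denoted $\|\partial_u\phi(\theta)\|_{\mathcal H}$. Distance and projection. $d(\theta,\theta^* )=\min\{\|\tilde\theta-\theta\|_2:\tilde\theta\in\Theta,\ \phi(\tilde\theta)=\phi(\theta^* )\}$ for $\theta\in\mathbb{R}^d$; $p(\theta,\theta^* )$ is the set of minimizers $\tilde\theta$; $\Lambda_\beta=\{\theta\in\Theta: d(\theta,\theta^* )<\beta\}$. $[\theta_1,\theta_2]$ is the line segment. Technical assumption on $\phi$ and radius $\beta$ with constants $C_{\phi,\theta^*},M_1,M_2$: (1) every $\theta\in\mathbb{R}^d$ with $d(\theta,\theta^* )<2\beta$ satisfies $\phi(\theta)\in\Sigma$; (2) $C_{\phi,\theta^*}>0$ and $\|\phi(\theta)-\phi(\theta^* )\|_{\mathcal H}\le C_{\phi,\theta^*}d(\theta,\theta^* )$ for all $\theta\in\Lambda_{2\beta}$; (3) $M_1=\sup_{\theta\in\phi^{-1}(\phi(\theta^* ))}\sup_{\|u\|_2=1}\|A\partial_u\phi(\theta)\|_2<+\infty$; (4) $M_2=\sup_{\theta\in\Lambda_{2\beta}}\sup_{\|u\|_2=\|v\|_2=1}\|A\partial_v\partial_u\phi(\theta)\|_2<+\infty$.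 $g$-basin of attraction. A set $\Lambda\subset\mathbb{R}^d$ with $\theta^*\in\Lambda$ is a $g$-basin of attraction of $\theta^*$ if there exists $\tau_0>0$ such that for any $\tau\in(0,\tau_0]$ and any $\theta_0\in\Lambda$, the sequence $\theta_{n+1}=\theta_n-\tau\nabla g(\theta_n)$ satisfies $g(\theta_n)\to g(\theta^* )$. Here $\nabla g=(\partial g/\partial\theta_i)_{1\le i\le d}$ is the Gateaux gradient. *)

(* Defs.v *)
From HB Require Import structures.
From mathcomp Require Import all_boot all_order all_algebra.
From mathcomp Require Import sesquilinear.
From mathcomp Require Export complex.
From mathcomp Require Import all_classical all_reals all_analysis.

Set Implicit Arguments.
Unset Strict Implicit.
Unset Printing Implicit Defensive.

Import Order.TTheory GRing.Theory Num.Theory.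
Import numFieldNormedType.Exports.

Local Open Scope classical_set_scope.
Local Open Scope ring_scope.
Local Open Scope complex_scope.

(* The library only puts a topology on abstract number fields and on K^o. *)
HB.instance Definition _ (R : realType) := NormedModule.copy R[i] R[i]^o.

Section Dual.
Context {R : realType} (D : normedModType R[i]).

Definition functional : {pred D -> R[i]} :=
  fun f => `[< scalar f /\ continuous f >].

Lemma functional_submod : submod_closed functional.
Proof.
split.
  apply/asboolP; split; last exact: cst_continuous.
  by move=> a x y; rewrite mulr0 addr0.
move=> a f g /asboolP[lf cf] /asboolP[lg cg]; apply/asboolP; split.
  move=> b x y; change (a * f (b *: x + y) + g (b *: x + y) =
    b * (a * f x + g x) + (a * f y + g y)).
  rewrite lf lg !mulrDr !mulrA [b * a]mulrC -!addrA; congr (_ + _).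
  by rewrite addrCA.
move=> x; apply: (@cvgD _ _ _ _ _ (a *: f) g); last exact: cg.
by apply: (@cvgM _ _ _ _ (cst a) f); [exact: cvg_cst|exact: cf].
Qed.

HB.instance Definition _ :=
  GRing.isSubmodClosed.Build _ _ functional functional_submod.

Record dual := Dual { dual_fun :> D -> R[i]; _ : dual_fun \in functional }.

HB.instance Definition _ := [isSub for dual_fun].
HB.instance Definition _ := [Choice of dual by <:].
HB.instance Definition _ := [SubChoice_isSubLmodule of dual by <:].

(* The topology of [dual] is the weak-* one, not the operator norm one. *)
HB.instance Definition _ := Topological.copy dual
  (initial_topology (dual_fun : dual -> {ptws D -> R[i]})).
HB.instance Definition _ := isPointed.Build dual 0.

End Dual.

Section Problem.
Context {R : realType} {D : completeNormedModType R[i]} {d m : nat}.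

Definition cone (Sigma : set (dual D)) : Prop :=
  forall x (a : R), Sigma x -> 0 < a -> Sigma (a%:C *: x).

Definition secant (Sigma : set (dual D)) : set (dual D) :=
  [set z | exists x y, [/\ Sigma x, Sigma y & z = x - y]].

Definition norm2 n (x : 'rV[R]_n) : R := Num.sqrt (\sum_i x 0 i ^+ 2).

Definition cnorm2 n (z : 'rV[R[i]]_n) : R :=
  Num.sqrt (\sum_i (complex.Re (z 0 i) ^+ 2 + complex.Im (z 0 i) ^+ 2)).

Definition line_segment (x y : 'rV[R]_d) : set 'rV[R]_d :=
  [set (1 - t) *: x + t *: y | t in `[0, 1]].

(* H is taken over the reals, since only real combinations of elements of the
   cone Sigma occur; a complex Hilbert space is covered by restricting its
   scalars and taking the real part of its inner product. The inclusion of
   Sigma in H is a map [emb], constrained only on real combinations of two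
   elements of Sigma; its other values are irrelevant. *)
Section Hilbert.
Context {H : completeNormedModType R}.

Definition hilbert_norm (ip : {dot H for idfun}) : Prop :=
  forall x : H, `|x| ^+ 2 = ip x x.

Definition contained_in_hilbert (Sigma : set (dual D)) (emb : dual D -> H) :=
  {in Sigma &, injective emb} /\
  forall x y (a b : R), Sigma x -> Sigma y ->
    emb (a%:C *: x + b%:C *: y) = a *: emb x + b *: emb y.

Definition rip (A : dual D -> 'rV[R[i]]_m) (T : set (dual D))
    (emb : dual D -> H) (gamma : R) : Prop :=
  forall x, T x ->
    (1 - gamma) * `|emb x| ^+ 2 <= cnorm2 (A x) ^+ 2 /\
    cnorm2 (A x) ^+ 2 <= (1 + gamma) * `|emb x| ^+ 2.

End Hilbert.

Definition diff_quotient (phi : 'rV[R]_d -> dual D) (theta u : 'rV[R]_d)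
    (h : R) : dual D :=
  (h^-1)%:C *: (phi (theta + h *: u) - phi theta).

(* limits are weak-*, this being the topology of [dual D] *)
Definition gateaux_differentiable (phi : 'rV[R]_d -> dual D) : Prop :=
  forall theta, exists2 L : 'rV[R]_d -> dual D,
    linear_for (fun (a : R) (x : dual D) => a%:C *: x) L &
    forall u, diff_quotient phi theta u h @[h --> 0^'] --> L u.

Definition gateaux (phi : 'rV[R]_d -> dual D) (u theta : 'rV[R]_d) : dual D :=
  lim (diff_quotient phi theta u h @[h --> 0^']).

Definition twice_gateaux_differentiable (phi : 'rV[R]_d -> dual D) : Prop :=
  gateaux_differentiable phi /\
  forall u, gateaux_differentiable (gateaux phi u).

Definition is_gateaux_hnorm {H : completeNormedModType R}
    (emb : dual D -> H) (phi : 'rV[R]_d -> dual D) (u theta : 'rV[R]_d)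
    (l : R) : Prop :=
  forall h : nat -> R, (forall n, h n != 0) -> `|h n| @[n --> \oo] --> 0 ->
    `|emb (diff_quotient phi theta u `|h n|)| @[n --> \oo] --> l.

Definition gateaux_hnorm {H : completeNormedModType R}
    (emb : dual D -> H) (phi : 'rV[R]_d -> dual D) (u theta : 'rV[R]_d) : R :=
  get (is_gateaux_hnorm emb phi u theta).

Definition compatible {H : completeNormedModType R} (Sigma : set (dual D))
    (emb : dual D -> H) (phi : 'rV[R]_d -> dual D) : Prop :=
  forall theta u, Sigma (phi theta) ->
    exists l, is_gateaux_hnorm emb phi u theta l.

Section Domain.
Variables (Sigma : set (dual D)) (phi : 'rV[R]_d -> dual D).

Definition fiber (thetas : 'rV[R]_d) : set 'rV[R]_d :=
  [set t | (phi @^-1` Sigma) t /\ phi t = phi thetas].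

(* for weak-* continuous phi and thetas in the preimage of Sigma, the fiber is
   closed and nonempty, so that this infimum is a minimum *)
Definition fiber_dist (theta thetas : 'rV[R]_d) : R :=
  inf [set norm2 (t - theta) | t in fiber thetas].

Definition fiber_proj (theta thetas : 'rV[R]_d) : set 'rV[R]_d :=
  [set t | fiber thetas t /\
    forall s, fiber thetas s -> norm2 (t - theta) <= norm2 (s - theta)].

Definition Lambda (thetas : 'rV[R]_d) (beta : R) : set 'rV[R]_d :=
  [set theta | (phi @^-1` Sigma) theta /\ fiber_dist theta thetas < beta].

Section Technical.
Variables (A : dual D -> 'rV[R[i]]_m) (thetas : 'rV[R]_d) (beta : R).

Definition M1 : \bar R :=
  ereal_sup [set ereal_sup [set (cnorm2 (A (gateaux phi u theta)))%:E
                           | u in [set u | norm2 u = 1]]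
            | theta in phi @^-1` [set phi thetas]].

Definition M2 : \bar R :=
  ereal_sup [set ereal_sup [set (cnorm2 (A (gateaux (gateaux phi uv.1) uv.2
                                              theta)))%:E
                           | uv in [set uv | norm2 uv.1 = 1 /\
                                             norm2 uv.2 = 1]]
            | theta in Lambda thetas (2 * beta)].

Definition technical_assumption {H : completeNormedModType R}
    (emb : dual D -> H) (C : R) : Prop :=
  [/\ forall theta, fiber_dist theta thetas < 2 * beta -> Sigma (phi theta),
      0 < C /\ (forall theta, Lambda thetas (2 * beta) theta ->
        `|emb (phi theta - phi thetas)| <= C * fiber_dist theta thetas),
      (M1 < +oo)%E &
      (M2 < +oo)%E].

End Technical.
End Domain.

Definition residual (A : dual D -> 'rV[R[i]]_m) (phi : 'rV[R]_d -> dual D)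
    (y : 'rV[R[i]]_m) (theta : 'rV[R]_d) : R :=
  cnorm2 (A (phi theta) - y) ^+ 2.

Definition global_minimizer (g : 'rV[R]_d -> R) (T : set 'rV[R]_d)
    (thetas : 'rV[R]_d) : Prop :=
  T thetas /\ forall theta, T theta -> g thetas <= g theta.

Definition gradient (g : 'rV[R]_d -> R) (theta : 'rV[R]_d) : 'rV[R]_d :=
  \row_i 'D_(delta_mx 0 i) g theta.

Definition basin_of_attraction (g : 'rV[R]_d -> R) (thetas : 'rV[R]_d)
    (L : set 'rV[R]_d) : Prop :=
  L thetas /\
  exists2 tau0 : R, 0 < tau0 &
    forall tau theta0, 0 < tau -> tau <= tau0 -> L theta0 ->
      g (iter n (fun t => t - tau *: gradient g t) theta0) @[n --> \oo]
        --> g thetas.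

End Problem.

(* a / b for 0 <= b, with value +oo for b = 0 whatever the sign of a *)
Definition quotient_oo {R : realType} (a b : R) : \bar R :=
  if b == 0 then +oo%E else (a / b)%:E.

(* Main.v *)
Require Import Defs.
From HB Require Import structures.
From mathcomp Require Import all_boot all_order all_algebra.
From mathcomp Require Import sesquilinear complex.
From mathcomp Require Import all_classical all_reals all_analysis.
From mathcomp Require Import ring lra.

Set Implicit Arguments.
Unset Strict Implicit.
Unset Printing Implicit Defensive.

Import Order.TTheory GRing.Theory Num.Theory.
Import numFieldNormedType.Exports.

Local Open Scope classical_set_scope.
Local Open Scope ring_scope.

(* By the RIP and the hypothesis on the quotient, g is convex along the segment
   joining a point x of Lambda_beta to its nearest point t in the fiber of
   thetas: the noise and the Lipschitz bound on phi control the misfit that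
   multiplies the second derivative of A phi.  Hence
     g x - g thetas <= <grad g x, x - t>.
   The bounds M1 and M2 make g smooth on Lambda_(2 beta), and since g >= g thetas
   there, a short gradient step shows |grad g|^2 <= K (g - g thetas) on
   Lambda_beta.  Together, for tau K <= 1, a gradient step from x satisfies
     |t - x'|^2 <= |t - x|^2 - tau (g x - g thetas),
   so the distance to the fiber does not increase, the iterates stay in
   Lambda_beta, and the gaps g(theta_n) - g thetas are summable. *)

(** * Cauchy-Schwarz and the triangle inequality for finite real families *)

Section EuclideanNorm.
Context {R : realType} {I : finType}.
Implicit Types f g : I -> R.

Definition inner f g : R := \sum_i f i * g i.

Definition l2norm f : R := Num.sqrt (\sum_i f i ^+ 2).

Lemma inner_ge0 f : 0 <= inner f f.
Proof. by apply: sumr_ge0 => i _; rewrite -expr2 sqr_ge0. Qed.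

Lemma sqr_l2norm f : l2norm f ^+ 2 = inner f f.
Proof. by rewrite sqr_sqrtr //; apply: inner_ge0. Qed.

Lemma l2norm_ge0 f : 0 <= l2norm f. Proof. exact: sqrtr_ge0. Qed.

Lemma innerC f g : inner f g = inner g f.
Proof. by apply: eq_bigr => i _; rewrite mulrC. Qed.

(** The squared norm of [inner g g * f - inner f g * g] is [inner g g] times the defect of the
    inequality; if [inner g g] is zero, [g] vanishes. *)
Lemma inner_sqr_le f g : inner f g ^+ 2 <= inner f f * inner g g.
Proof.
have lin a b : inner (fun i => a * f i - b * g i) (fun i => a * f i - b * g i) =
    a ^+ 2 * inner f f - 2 * a * b * inner f g + b ^+ 2 * inner g g.
  rewrite /inner !mulr_sumr -sumrN -!big_split /=.
  by apply: eq_bigr => i _; ring.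
have := inner_ge0 g; rewrite le_eqVlt => /predU1P[gg0|gg0].
  have g0 i : g i = 0.
    have /(_ i isT)/eqP := psumr_eq0P (fun i _ => sqr_ge0 (g i)) (esym gg0).
    by rewrite sqrf_eq0 => /eqP.
  by rewrite -gg0 mulr0 /inner big1 ?expr0n // => i _; rewrite g0 mulr0.
have := inner_ge0 (fun i => inner g g * f i - inner f g * g i).
rewrite lin => h.
suff : 0 <= inner g g * (inner f f * inner g g - inner f g ^+ 2).
  by rewrite pmulr_rge0 // subr_ge0.
by apply: le_trans h _; rewrite le_eqVlt; apply/orP; left; apply/eqP; ring.
Qed.

Lemma normr_inner_le f g : `|inner f g| <= l2norm f * l2norm g.
Proof.
rewrite -ler_sqr ?nnegrE ?mulr_ge0 ?l2norm_ge0 //.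
by rewrite real_normK ?num_real // exprMn !sqr_l2norm inner_sqr_le.
Qed.

Lemma inner_le f g : inner f g <= l2norm f * l2norm g.
Proof. exact: le_trans (ler_norm _) (normr_inner_le f g). Qed.

Lemma l2normD f g : l2norm (fun i => f i + g i) <= l2norm f + l2norm g.
Proof.
rewrite -ler_sqr ?nnegrE ?addr_ge0 ?l2norm_ge0 // sqrrD !sqr_l2norm.
have -> : inner (fun i => f i + g i) (fun i => f i + g i) =
    inner f f + inner f g *+ 2 + inner g g.
  rewrite /inner -sumrMnl -!big_split /=.
  by apply: eq_bigr => i _; ring.
by rewrite lerD2r lerD2l lerMn2r /= inner_le.
Qed.

Lemma l2normZ a f : l2norm (fun i => a * f i) = `|a| * l2norm f.
Proof.
rewrite /l2norm -sqrtr_sqr -sqrtrM ?sqr_ge0 // mulr_sumr.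
by congr Num.sqrt; apply: eq_bigr => i _; rewrite exprMn.
Qed.

End EuclideanNorm.

(** * Directional derivatives along lines and mean value expansions *)

Section LineDerivatives.
Context {R : realType}.

(** Both difference quotients are the same function of [h]; a directional derivative thus becomes an
    ordinary one. *)
Lemma is_derive_line {V : normedModType R} (f : V -> R) (x v : V) (s df : R) :
  is_derive (x + s *: v) v f df ->
  is_derive s 1 (fun r => f (x + r *: v)) df.
Proof.
move=> [dl dv].
have E : (fun h : R => h^-1 *: (((fun r => f (x + r *: v)) \o shift s) (h *: 1)
      - f (x + s *: v)))
    = (fun h => h^-1 *: ((f \o shift (x + s *: v)) (h *: v) - f (x + s *: v))).
  apply/funext => h /=; congr (_ *: (f _ - _)).
  by rewrite addrCA -scalerDl [h *: 1]mulr1.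
by split; rewrite /derivable /derive E.
Qed.

Lemma is_derive_inner {V : normedModType R} {I : finType} (f g : V -> I -> R)
    (x v : V) (df dg : I -> R) :
  (forall i, is_derive x v (f ^~ i) (df i)) ->
  (forall i, is_derive x v (g ^~ i) (dg i)) ->
  is_derive x v (fun z => inner (f z) (g z)) (inner df (g x) + inner (f x) dg).
Proof.
move=> hf hg.
have -> : (fun z => inner (f z) (g z)) = \sum_i (f ^~ i * g ^~ i).
  by apply/funext => z; rewrite fct_sumE.
rewrite /inner -big_split /=.
elim/big_ind2 : _ => // [||i _].
- exact: is_derive_cst.
- by move=> a b a' b' ha hb; exact: is_deriveD.
- apply: (is_derive_eq (is_deriveM (hf i) (hg i))).
  by rewrite addrC; congr (_ + _); rewrite [LHS]mulrC.
Qed.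

Lemma MVT_ge0 (f df : R -> R) (a : R) : 0 <= a ->
  (forall s : R, is_derive s 1 f (df s)) ->
  exists2 c, 0 <= c <= a & f a = f 0 + a * df c.
Proof.
move=> a0 hf.
have [|c] := @MVT_segment R f df 0 a a0 (fun s _ => hf s).
  by apply: derivable_within_continuous => s _; exact: ex_derive.
rewrite in_itv /= => c0a e; exists c => //.
by rewrite -[f a](subrK (f 0)) e subr0 addrC mulrC.
Qed.

(** The mean value theorem is used on [[0, a]], then on [[0, b]]; hence the factor [a * b] where
    Taylor's formula has half of [a ^+ 2]. *)
Lemma second_order_expansion (f f1 f2 : R -> R) (a : R) : 0 <= a ->
  (forall s : R, is_derive s 1 f (f1 s)) ->
  (forall s : R, is_derive s 1 f1 (f2 s)) ->
  exists b c, [/\ 0 <= b <= a, 0 <= c <= a &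
                 f a = f 0 + a * f1 0 + a * b * f2 c].
Proof.
move=> a0 hf hf1; have [b /andP[b0 ba] ->] := MVT_ge0 a0 hf.
have [c /andP[c0 cb] ->] := MVT_ge0 b0 hf1.
exists b, c; split; rewrite ?b0 ?c0 ?(le_trans cb) //=.
by rewrite mulrDr addrA mulrA.
Qed.

End LineDerivatives.

(** * Euclidean geometry of row vectors and convergence of gradient descent *)

Section GradientDescent.
Context {R : realType} {d : nat}.
Implicit Types (u v x t : 'rV[R]_d) (g : 'rV[R]_d -> R).

Definition rdot u v : R := inner (u 0) (v 0).

Lemma sqr_norm2 u : norm2 u ^+ 2 = rdot u u.
Proof. exact: sqr_l2norm. Qed.

Lemma norm2_ge0 u : 0 <= norm2 u. Proof. exact: l2norm_ge0. Qed.

Lemma norm2Z a u : norm2 (a *: u) = `|a| * norm2 u.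
Proof.
rewrite -l2normZ /norm2 /l2norm.
by congr Num.sqrt; apply: eq_bigr => i _; rewrite mxE.
Qed.

Lemma norm2N u : norm2 (- u) = norm2 u.
Proof. by rewrite -scaleN1r norm2Z normrN1 mul1r. Qed.

Lemma norm2D u v : norm2 (u + v) <= norm2 u + norm2 v.
Proof.
apply: le_trans (l2normD _ _).
by rewrite /norm2 /l2norm; under eq_bigr do rewrite mxE.
Qed.

Lemma norm2_eq0 u : norm2 u = 0 -> u = 0.
Proof.
move=> u0; have : norm2 u ^+ 2 = 0 by rewrite u0 expr0n.
rewrite sqr_norm2 => /psumr_eq0P h; apply/rowP => i; rewrite mxE.
have /(_ i isT)/eqP := h (fun i _ => sqr_ge0 (u 0 i)).
by rewrite sqrf_eq0 => /eqP.
Qed.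

(** Serves to extend bounds on unit vectors to all vectors; the first alternative covers the zero
    vector, which has no direction. *)
Lemma norm2_unit u : exists2 w, u = norm2 u *: w & norm2 u = 0 \/ norm2 w = 1.
Proof.
have [u0|u0] := eqVneq (norm2 u) 0.
  by exists 0; [rewrite scaler0; exact: norm2_eq0|left].
exists ((norm2 u)^-1 *: u); first by rewrite scalerA divff // scale1r.
by right; rewrite norm2Z ger0_norm ?invr_ge0 ?norm2_ge0 // mulVf.
Qed.

Lemma sqr_norm2D u v a :
  norm2 (u + a *: v) ^+ 2 = norm2 u ^+ 2 + 2 * a * rdot u v + a ^+ 2 * norm2 v ^+ 2.
Proof.
rewrite !sqr_norm2 /rdot /inner !mulr_sumr -!big_split /=.
by apply: eq_bigr => i _; rewrite !mxE; ring.
Qed.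

Definition within_dist (T : set 'rV[R]_d) (r : R) x : Prop :=
  exists2 t, T t & norm2 (t - x) < r.

Definition nearest (T : set 'rV[R]_d) x t : Prop :=
  T t /\ forall s, T s -> norm2 (t - x) <= norm2 (s - x).

(** Each step lowers the squared distance to [T] by at least [tau] times the current gap, so
    [norm2 (t - x n) ^+ 2 + tau * S n] stays below its initial value for suitable [t]. *)
Lemma gradient_descent_cvg g (T : set 'rV[R]_d) (gmin beta K tau : R) :
  0 < tau -> tau * K <= 1 ->
  (forall x, within_dist T beta x ->
    [/\ gmin <= g x,
        norm2 (gradient g x) ^+ 2 <= K * (g x - gmin) &
        exists2 t, nearest T x t &
          g x - gmin <= - rdot (t - x) (gradient g x)]) ->
  forall x0, within_dist T beta x0 ->
  g (iter n (fun x => x - tau *: gradient g x) x0) @[n --> \oo] --> gmin.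
Proof.
move=> tau0 tauK hg x0 [t0 Tt0 t0b].
pose x n := iter n (fun x => x - tau *: gradient g x) x0.
pose r0 := norm2 (t0 - x0).
pose S n := \sum_(0 <= k < n) (g (x k) - gmin).
(* As [r0 < beta], the invariant keeps the iterate where [hg] is available. *)
have close n t : norm2 (t - x n) ^+ 2 + tau * S n <= r0 ^+ 2 -> 0 <= S n ->
    norm2 (t - x n) < beta.
  move=> tn s0; apply: le_lt_trans t0b.
  rewrite -ler_sqr ?nnegrE ?norm2_ge0 //.
  by apply: le_trans tn; rewrite lerDl mulr_ge0 // ltW.
have key n : exists2 t, T t &
    norm2 (t - x n) ^+ 2 + tau * S n <= r0 ^+ 2 /\ 0 <= S n.
  elim: n => [|n [t Tt [tn s0]]].
    by exists t0 => //; rewrite /S big_geq // mulr0 addr0.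
  have tb := close _ _ tn s0.
  have [gge gK [p [Tp pmin] pdot]] := hg _ (ex_intro2 _ _ t Tt tb).
  (* The witness moves to the point of [T] nearest to the iterate, for which the gradient inequality
     holds; the distance does not grow. *)
  exists p => //; rewrite /S big_nat_recr //= -/(S n); split; last first.
    by rewrite addr_ge0 // subr_ge0.
  have -> : p - (x n - tau *: gradient g (x n)) =
      (p - x n) + tau *: gradient g (x n) by rewrite opprB addrCA addrC.
  have pt : norm2 (p - x n) ^+ 2 <= norm2 (t - x n) ^+ 2.
    by rewrite ler_sqr ?nnegrE ?norm2_ge0 // pmin.
  rewrite sqr_norm2D; apply: le_trans tn.
  (* The quadratic term costs at most [tau] times the gap because [tau * K <= 1], while the cross
     term gains twice as much; the difference pays for the new summand of [S]. *)
  have h1 : tau ^+ 2 * norm2 (gradient g (x n)) ^+ 2 <=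
      tau * (g (x n) - gmin).
    apply: le_trans (_ : tau ^+ 2 * (K * (g (x n) - gmin)) <= _).
      by rewrite ler_wpM2l // sqr_ge0.
    rewrite expr2 -mulrA ler_wpM2l ?(ltW tau0) // mulrA ler_piMl // subr_ge0 //.
  have h2 : tau * rdot (p - x n) (gradient g (x n)) <= tau * - (g (x n) - gmin).
    by rewrite ler_wpM2l ?(ltW tau0) // lerNr.
  move: h1 h2 pt; rewrite -(mulrA 2) [tau * (_ + _)]mulrDr mulrN; lra.
have ge n : 0 <= g (x n) - gmin.
  have [t Tt [tn s0]] := key n.
  have tb := close _ _ tn s0.
  by have [gge _ _] := hg _ (ex_intro2 _ _ t Tt tb); rewrite subr_ge0.
have /cvg_series_cvg_0 h : cvgn (series (fun k => g (x k) - gmin)).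
  apply: nondecreasing_is_cvgn.
    by apply/nondecreasing_seqP => n; rewrite /series /= big_nat_recr //= lerDl.
  exists (r0 ^+ 2 / tau) => _ [n _ <-].
  have [t _ [tn _]] := key n; rewrite ler_pdivlMr // mulrC.
  by apply: le_trans tn; rewrite lerDr sqr_ge0.
have -> : gmin = 0 + gmin by rewrite add0r.
have -> : (fun n => g (iter n (fun x => x - tau *: gradient g x) x0)) =
    (fun n => (g (x n) - gmin) + gmin) by apply/funext => n; rewrite subrK.
by apply: cvgD h _; exact: cvg_cst.
Qed.

End GradientDescent.

(** * Nonlinear least squares with directional derivatives [G] and [S] *)

Section LeastSquares.
Context {R : realType} {d : nat} {I : finType}.
Variables (F : 'rV[R]_d -> I -> R) (y : I -> R).
Variable G : 'rV[R]_d -> 'rV[R]_d -> I -> R.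
Variable S : 'rV[R]_d -> 'rV[R]_d -> 'rV[R]_d -> I -> R.
Hypothesis derF : forall x u i, is_derive x u (F ^~ i) (G u x i).
Hypothesis derG : forall x u v i, is_derive x v (G u ^~ i) (S u v x i).
Hypothesis linG : forall x u v a i, G (a *: u + v) x i = a * G u x i + G v x i.

Definition misfit x i := F x i - y i.
Definition cost x := inner (misfit x) (misfit x).

Lemma is_derive_misfit x u i : is_derive x u (misfit ^~ i) (G u x i).
Proof.
apply: (is_derive_eq (is_deriveB (derF x u i) (is_derive_cst (y i) x u))).
by rewrite subr0.
Qed.

Lemma is_derive_cost x u : is_derive x u cost (2 * inner (G u x) (misfit x)).
Proof.
apply: (is_derive_eq (is_derive_inner (is_derive_misfit x u) (is_derive_misfit x u))).
by rewrite [X in _ + X]innerC; ring.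
Qed.

Lemma is_derive2_cost x u v : is_derive x v
  (fun z => 2 * inner (G u z) (misfit z))
  (2 * (inner (S u v x) (misfit x) + inner (G u x) (G v x))).
Proof.
exact: (is_deriveZ 2 (is_derive_inner (derG x u v) (is_derive_misfit x v))).
Qed.

Lemma G0 x i : G 0 x i = 0.
Proof.
have := linG x 0 0 1 i; rewrite scale1r addr0 mul1r => /eqP.
by rewrite -subr_eq subrr eq_sym => /eqP.
Qed.

(** The gradient only collects partial derivatives; expanding [v] in the standard basis and
    linearity of [G] in the direction recover the derivative along [v]. *)
Lemma rdot_gradient_cost x v :
  rdot v (gradient cost x) = 2 * inner (G v x) (misfit x).
Proof.
have Gsum i : G v x i = \sum_j v 0 j * G (delta_mx 0 j) x i.
  rewrite {1}[v]row_sum_delta.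
  elim/big_ind2 : _ => [|a b a' b' ha hb|j _]; first exact: G0.
    by have := linG x b b' 1 i; rewrite scale1r mul1r ha hb.
  by have := linG x (delta_mx 0 j) 0 (v 0 j) i; rewrite addr0 G0 addr0.
rewrite /rdot /inner mulr_sumr.
under [RHS]eq_bigr do rewrite Gsum mulr_suml mulr_sumr.
rewrite exchange_big /=; apply: eq_bigr => j _.
rewrite mxE (derive_val (is_derive := is_derive_cost _ _)) /inner !mulr_sumr.
by apply: eq_bigr => i _; ring.
Qed.

Lemma cost_expansion x v (a : R) : 0 <= a ->
  exists b c, [/\ 0 <= b <= a, 0 <= c <= a &
    cost (x + a *: v) = cost x + a * rdot v (gradient cost x) +
      a * b * (2 * (inner (S v v (x + c *: v)) (misfit (x + c *: v)) +
                    inner (G v (x + c *: v)) (G v (x + c *: v))))].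
Proof.
move=> a0.
have [b [c [hb hc e]]] := second_order_expansion a0
  (fun s => is_derive_line (is_derive_cost (x + s *: v) v))
  (fun s => is_derive_line (is_derive2_cost (x + s *: v) v v)).
by exists b, c; split => //; rewrite e /= scale0r addr0 rdot_gradient_cost.
Qed.

(** The expansion at [x] with [a = 1] reaches [t]. The hypothesis is that half of the second
    derivative of [cost] is nonnegative along the segment, so the remainder is too. *)
Lemma convex_cost_le x t :
  (forall s, 0 <= s <= 1 -> 0 <=
    inner (S (t - x) (t - x) (x + s *: (t - x))) (misfit (x + s *: (t - x))) +
    inner (G (t - x) (x + s *: (t - x))) (G (t - x) (x + s *: (t - x)))) ->
  cost x - cost t <= - rdot (t - x) (gradient cost x).
Proof.
move=> h; have [b [c [/andP[b0 _] hc]]] := cost_expansion x (t - x) ler01.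
rewrite scale1r subrKC !mul1r => ->.
have := mulr_ge0 b0 (mulr_ge0 (ler0n R 2) (h c hc)); lra.
Qed.

Variables (T : set 'rV[R]_d) (beta M1 M2 B gmin : R).
Hypothesis beta0 : 0 < beta.
Hypothesis M10 : 0 <= M1.
Hypothesis M20 : 0 <= M2.
Hypothesis B0 : 0 <= B.
Hypothesis boundG : forall t u, T t -> l2norm (G u t) <= M1 * norm2 u.
Hypothesis boundS : forall x u v, within_dist T (2 * beta) x ->
  l2norm (S u v x) <= M2 * norm2 u * norm2 v.
Hypothesis boundF : forall x, within_dist T (2 * beta) x ->
  l2norm (misfit x) <= B.
Hypothesis gmin_le : forall x, within_dist T (2 * beta) x -> gmin <= cost x.

Definition slope_bound := M1 + M2 * (2 * beta).

Lemma slope_bound_ge0 : 0 <= slope_bound.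
Proof. by rewrite addr_ge0 // mulr_ge0 // mulr_ge0 // ltW. Qed.

(** [M1] bounds [G u] at a nearby point [t] of [T], and from [t] to [x] it changes by at most [M2]
    times the distance, up to the factor [norm2 u]. *)
Lemma boundG_near x u : within_dist T (2 * beta) x ->
  l2norm (G u x) <= slope_bound * norm2 u.
Proof.
move=> [t Tt tx]; pose w i := G u x i - G u t i.
have wM : l2norm w <= M2 * (2 * beta) * norm2 u.
  have [/eqP ->|w0] := boolP (l2norm w == 0).
    by rewrite !mulr_ge0 ?norm2_ge0 // ltW.
  (* Pairing with the increment [w] itself gives a real function, to which the mean value theorem
     applies and whose own increment is [inner w w]. *)
  have [c /andP[c0 c1]] := MVT_ge0 ler01 (fun s => is_derive_line
    (is_derive_inner (fun i => is_derive_cst (w i) (t + s *: (x - t)) (x - t))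
       (derG (t + s *: (x - t)) u (x - t)))).
  rewrite scale1r scale0r addr0 subrKC mul1r => e.
  set z := t + c *: (x - t) in e.
  have wz : inner w w = inner w (S u (x - t) z).
    have -> : inner w w = inner w (G u x) - inner w (G u t).
      by rewrite /inner -sumrB; apply: eq_bigr => i _; rewrite /w mulrBr.
    have z0 : inner (fun=> 0) (G u z) = 0 by apply: big1 => i _; rewrite mul0r.
    by rewrite e z0 add0r addrAC subrr add0r.
  have zT : within_dist T (2 * beta) z.
    exists t => //; rewrite opprD addNKr norm2N norm2Z ger0_norm //.
    apply: le_lt_trans tx; rewrite -[X in _ <= X]norm2N opprB.
    by rewrite ler_piMl // norm2_ge0.
  rewrite -(ler_pM2l (_ : 0 < l2norm w)) ?lt_def ?w0 ?l2norm_ge0 //.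
  rewrite -expr2 sqr_l2norm wz; apply: le_trans (inner_le _ _) _.
  rewrite ler_wpM2l ?l2norm_ge0 //; apply: le_trans (boundS _ _ zT) _.
  rewrite mulrAC ler_wpM2r ?norm2_ge0 // ler_wpM2l //.
  by rewrite -norm2N opprB ltW.
have -> : G u x = fun i => w i + G u t i.
  by apply/funext => i; rewrite /w subrK.
apply: le_trans (l2normD _ _) _; rewrite mulrDl addrC.
by apply: lerD => //; exact: boundG.
Qed.

Definition gradient_bound := 2 * slope_bound * B.
(** Bounds the second derivative of [cost] in unit directions: [M2 * B] for [S] against the misfit,
    [slope_bound ^+ 2] for the Gauss-Newton term. *)
Definition curvature_bound := 2 * (M2 * B + slope_bound ^+ 2).

Lemma gradient_bound_ge0 : 0 <= gradient_bound.
Proof. by apply: mulr_ge0 => //; apply: mulr_ge0 => //; exact: slope_bound_ge0. Qed.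

Lemma curvature_bound_ge0 : 0 <= curvature_bound.
Proof. by apply: mulr_ge0 => //; rewrite addr_ge0 ?sqr_ge0 // mulr_ge0. Qed.

(** Testing the gradient against itself yields a derivative of [cost] bounded linearly in its norm;
    one factor of the norm cancels. *)
Lemma norm2_gradient_le x : within_dist T (2 * beta) x ->
  norm2 (gradient cost x) <= gradient_bound.
Proof.
move=> xT; have [->|n0] := eqVneq (norm2 (gradient cost x)) 0.
  exact: gradient_bound_ge0.
rewrite -(ler_pM2l (_ : 0 < norm2 (gradient cost x))) ?lt_def ?n0 ?norm2_ge0 //.
rewrite -expr2 sqr_norm2 rdot_gradient_cost.
set v := gradient cost x.
have h := boundG_near v xT; have h' := boundF xT.
have : l2norm (G v x) * l2norm (misfit x) <=
    slope_bound * norm2 v * B.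
  by rewrite ler_pM ?l2norm_ge0.
have := inner_le (G v x) (misfit x); rewrite /gradient_bound; lra.
Qed.

(** A trial step [s] against the gradient stays within [2 * beta] of [T] and lowers [cost] by at
    least [s / 2] times the squared gradient norm, yet not below [gmin]. *)
Lemma sqr_norm2_gradient_le x (s : R) : within_dist T beta x ->
  0 < s -> s * curvature_bound <= 2^-1 -> s * gradient_bound <= beta ->
  norm2 (gradient cost x) ^+ 2 <= 2 / s * (cost x - gmin).
Proof.
move=> [t Tt tx] s0 sC sB; set v := gradient cost x.
have near r : 0 <= r <= s -> within_dist T (2 * beta) (x + r *: - v).
  move=> /andP[r0 rs]; exists t => //; rewrite opprD addrA -scalerN opprK.
  apply: le_lt_trans (norm2D _ _) _; rewrite mulr_natl mulr2n ltr_leD //.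
  rewrite norm2Z ger0_norm //; apply: le_trans sB.
  rewrite ler_pM ?norm2_ge0 //; apply: norm2_gradient_le.
  by exists t => //; apply: lt_trans tx _; rewrite mulr_natl mulr2n ltrDl.
have [b [c [/andP[b0 bs] hc e]]] := cost_expansion x (- v) (ltW s0).
have := gmin_le (near s _); rewrite lexx (ltW s0) => /(_ isT).
rewrite {}e; set z := x + c *: - v; have zT : within_dist T (2 * beta) z := near c hc.
have -> : rdot (- v) (gradient cost x) = - norm2 v ^+ 2.
  rewrite sqr_norm2 /rdot /inner -sumrN.
  by apply: eq_bigr => i _; rewrite mxE mulNr.
have h : 2 * (inner (S (- v) (- v) z) (misfit z) + inner (G (- v) z) (G (- v) z))
    <= curvature_bound * norm2 v ^+ 2.
  rewrite -mulrA ler_wpM2l // mulrDl; apply: lerD.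
    apply: le_trans (inner_le _ _) _.
    rewrite mulrAC; apply: ler_pM; rewrite ?l2norm_ge0 //; last exact: boundF.
    by apply: le_trans (boundS _ _ zT) _; rewrite norm2N expr2 mulrA.
  rewrite -sqr_l2norm -exprMn ler_sqr ?nnegrE ?l2norm_ge0 //.
    by rewrite -[norm2 v]norm2N; exact: boundG_near.
  by rewrite mulr_ge0 ?norm2_ge0 // slope_bound_ge0.
set Q := 2 * _ in h *.
(* Since [b <= s], the remainder uses up at most half of the first-order decrease. *)
have h2 : s * b * Q <= s * (2^-1 * norm2 v ^+ 2).
  rewrite -mulrA ler_wpM2l ?(ltW s0) //.
  apply: (@le_trans _ _ (b * (curvature_bound * norm2 v ^+ 2))).
    by rewrite ler_wpM2l.
  rewrite mulrA ler_wpM2r ?sqr_ge0 //; apply: le_trans sC.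
  by rewrite ler_wpM2r ?curvature_bound_ge0.
move=> h3; rewrite -mulrA mulrCA -ler_pdivrMl ?invr_gt0 // invrK.
by move: h2 h3; rewrite -/v mulrN [s * (_ * _)]mulrCA; lra.
Qed.

Lemma gradient_descent_least_squares :
  (forall x, within_dist T beta x -> exists t, [/\ nearest T x t, cost t = gmin &
    forall s, 0 <= s <= 1 -> 0 <=
      inner (S (t - x) (t - x) (x + s *: (t - x))) (misfit (x + s *: (t - x))) +
      inner (G (t - x) (x + s *: (t - x))) (G (t - x) (x + s *: (t - x)))]) ->
  exists2 tau0 : R, 0 < tau0 & forall tau x0, 0 < tau -> tau <= tau0 ->
    within_dist T beta x0 ->
    cost (iter n (fun x => x - tau *: gradient cost x) x0) @[n --> \oo] --> gmin.
Proof.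
move=> conv.
(* The two terms meet the two conditions on the trial step; adding 1 keeps the denominators
   positive. The gradient bound then has [K = 2 / s], so [tau <= s / 2] gives [tau * K <= 1]. *)
pose s := Num.min (2^-1 / (curvature_bound + 1)) (beta / (gradient_bound + 1)).
have C1 : 0 < curvature_bound + 1 by rewrite ltr_wpDl ?curvature_bound_ge0.
have B1 : 0 < gradient_bound + 1 by rewrite ltr_wpDl ?gradient_bound_ge0.
have s0 : 0 < s by rewrite lt_min !divr_gt0.
exists (s / 2); first by rewrite divr_gt0.
move=> tau x0 tau0 taus x0T.
apply: (@gradient_descent_cvg _ _ cost T gmin beta (2 / s) tau) => //.
  apply: le_trans (_ : s / 2 * (2 / s) <= 1).
    by rewrite ler_wpM2r // divr_ge0 ?ltW.
  by rewrite mulrA mulfVK ?pnatr_eq0 // divff ?gt_eqF.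
move=> x xT; split.
- apply: gmin_le; have [t Tt tx] := xT; exists t => //.
  by apply: lt_trans tx _; rewrite mulr_natl mulr2n ltrDl.
- apply: sqr_norm2_gradient_le => //.
    apply: (@le_trans _ _ (s * (curvature_bound + 1))).
      by rewrite ler_wpM2l ?(ltW s0) // lerDl.
    by rewrite -ler_pdivlMr // ge_min lexx.
  apply: (@le_trans _ _ (s * (gradient_bound + 1))).
    by rewrite ler_wpM2l ?(ltW s0) // lerDl.
  by rewrite -ler_pdivlMr // ge_min lexx orbT.
- have [t [tx <- h]] := conv x xT; exists t => //; exact: convex_cost_le.
Qed.

End LeastSquares.

(** * Complex vectors as families of real coordinates *)

Section RealCoordinates.
Context {R : realType}.

Lemma continuous_Re : continuous (@complex.Re R : R[i]^o -> R).
Proof.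
move=> z; apply/(@cvgrPdist_lt _ _ _ _ (nbhs_filter (z : R[i]^o))) => e e0.
exists e%:C%C => [|w /= zw]; first by rewrite /= ltcR.
by rewrite -ltcR; apply: le_lt_trans zw; rewrite -raddfB; exact: normc_ge_Re.
Qed.

Lemma continuous_Im : continuous (@complex.Im R : R[i]^o -> R).
Proof.
move=> z; apply/(@cvgrPdist_lt _ _ _ _ (nbhs_filter (z : R[i]^o))) => e e0.
exists e%:C%C => [|w /= zw]; first by rewrite /= ltcR.
rewrite -ltcR; apply: le_lt_trans zw; rewrite -raddfB normc_def lecR -sqrtr_sqr.
by rewrite ler_sqrt ?addr_ge0 ?sqr_ge0 // lerDr sqr_ge0.
Qed.

(** Identifies complex [m]-space with real [2m]-space, where the real least squares results
    apply. *)
Definition reim {m} (z : 'rV[R[i]]_m) (i : 'I_m + 'I_m) : R :=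
  match i with inl l => complex.Re (z 0 l) | inr l => complex.Im (z 0 l) end.

Lemma l2norm_reim m (z : 'rV[R[i]]_m) : l2norm (reim z) = cnorm2 z.
Proof. by rewrite /l2norm /cnorm2 big_sumType big_split. Qed.

Lemma reimD m (z w : 'rV[R[i]]_m) i : reim (z + w) i = reim z i + reim w i.
Proof. by case: i => l /=; rewrite mxE raddfD. Qed.

Lemma reimB m (z w : 'rV[R[i]]_m) i : reim (z - w) i = reim z i - reim w i.
Proof. by case: i => l /=; rewrite !mxE raddfB. Qed.

Lemma reimZ m (a : R) (z : 'rV[R[i]]_m) i : reim (a%:C%C *: z) i = a * reim z i.
Proof.
by case: i => l /=; rewrite mxE; case: (z 0 l) => p q /=; rewrite mul0r ?subr0 ?addr0.
Qed.

Lemma continuous_reim m i : continuous (fun z : 'rV[R[i]]_m => reim z i).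
Proof.
case: i => l z.
- exact: (continuous_comp (coord_continuous (i := 0) (j := l) (x := z))
                          (continuous_Re (x := z 0 l))).
- exact: (continuous_comp (coord_continuous (i := 0) (j := l) (x := z))
                          (continuous_Im (x := z 0 l))).
Qed.

End RealCoordinates.

Lemma is_derive_unique {R : numFieldType} {V W : normedModType R} (f : V -> W)
  (x v : V) (a b : W) : is_derive x v f a -> is_derive x v f b -> a = b.
Proof. by move=> [_ <-] [_ <-]. Qed.

(** * Weak-* Gateaux derivatives seen through [A] *)

Section GateauxDerivatives.
Context {R : realType} {D : completeNormedModType R[i]} {d m : nat}.
Variable A : {linear dual D -> 'rV[R[i]]_m}.
Hypothesis contA : continuous A.
Implicit Types (psi : 'rV[R]_d -> dual D) (x u v : 'rV[R]_d).

Definition measurement psi x := reim (A (psi x)).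

Lemma gateaux_cvg psi x u : gateaux_differentiable psi ->
  diff_quotient psi x u h @[h --> 0^'] --> gateaux psi u x.
Proof. by move=> /(_ x)[L _ /(_ u)]; exact: cvgP. Qed.

Lemma measurement_cvg {T : Type} {E : set_system T} {FE : Filter E}
    (f : T -> dual D) (l : dual D) i :
  f t @[t --> E] --> l -> reim (A (f t)) i @[t --> E] --> reim (A l) i.
Proof.
move=> fl.
have c : {for l, continuous ((fun z => reim z i) \o A)}.
  by apply: continuous_comp; [exact: contA|exact: continuous_reim].
exact: (cvg_comp _ _ fl c).
Qed.

Lemma measurement_diff_quotient psi x u (h : R) i :
  reim (A (diff_quotient psi x u h)) i =
  h^-1 * (measurement psi (x + h *: u) i - measurement psi x i).
Proof. by rewrite linearZ reimZ linearB reimB. Qed.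

Lemma is_derive_measurement_lim psi x u l i :
  diff_quotient psi x u h @[h --> 0^'] --> l ->
  is_derive x u (measurement psi ^~ i) (reim (A l) i).
Proof.
move=> /(measurement_cvg (i := i)) dl.
have E : (fun h : R => h^-1 *: ((measurement psi ^~ i \o shift x) (h *: u)
      - measurement psi x i)) = (fun h => reim (A (diff_quotient psi x u h)) i).
  by apply/funext => h; rewrite measurement_diff_quotient /= [h *: u + x]addrC.
by split; rewrite /derivable /derive E; [exact: cvgP dl|exact: cvg_lim dl].
Qed.

Lemma is_derive_measurement psi x u i : gateaux_differentiable psi ->
  is_derive x u (measurement psi ^~ i) (measurement (gateaux psi u) x i).
Proof. by move=> /gateaux_cvg h; exact: is_derive_measurement_lim. Qed.

Lemma measurement_gateaux_linear psi x u v (a : R) i : gateaux_differentiable psi ->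
  measurement (gateaux psi (a *: u + v)) x i =
  a * measurement (gateaux psi u) x i + measurement (gateaux psi v) x i.
Proof.
move=> dpsi; have [L linL cvgL] := dpsi x.
(* Both are limits of the same quotients; comparing them after measurement calls only on uniqueness
   of real limits. *)
have GL w : measurement (gateaux psi w) x i = reim (A (L w)) i.
  exact: is_derive_unique (is_derive_measurement x w i dpsi)
                          (is_derive_measurement_lim i (cvgL w)).
by rewrite !GL linL linearD reimD linearZ reimZ.
Qed.

(** Homogeneity in [v] is linearity of the outer derivative. For [u], the measured inner derivatives
    differ by the factor [a] at every point, so this identity can be differentiated along [v]. *)
Lemma measurement_gateaux2Z psi x u v (a b : R) i :
  twice_gateaux_differentiable psi ->
  measurement (gateaux (gateaux psi (a *: u)) (b *: v)) x i =
  a * b * measurement (gateaux (gateaux psi u) v) x i.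
Proof.
move=> [dpsi d2psi].
have Z chi w c z : gateaux_differentiable chi ->
    measurement (gateaux chi (c *: w)) z i = c * measurement (gateaux chi w) z i.
  move=> dchi; have := measurement_gateaux_linear z w 0 c i dchi.
  rewrite addr0 => ->; have := measurement_gateaux_linear z 0 0 1 i dchi.
  by rewrite scale1r addr0 mul1r => /eqP; rewrite -subr_eq subrr => /eqP <-; rewrite addr0.
have Za : measurement (gateaux psi (a *: u)) ^~ i =
    a \*: (measurement (gateaux psi u) ^~ i).
  by apply/funext => z; exact: Z.
have h1 := is_derive_measurement x v i (d2psi (a *: u)).
have h2 := is_deriveZ a (is_derive_measurement x v i (d2psi u)).
rewrite Za in h1.
have e := is_derive_unique h1 h2.
apply: etrans (Z _ _ _ _ (d2psi (a *: u))) _.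
exact: etrans (congr1 ( *%R b) e) (etrans (mulrCA _ _ _) (mulrA _ _ _)).
Qed.

Lemma residual_cost psi (y : 'rV[R[i]]_m) :
  residual A psi y = cost (measurement psi) (reim y).
Proof.
apply/funext => x; rewrite /residual -l2norm_reim sqr_l2norm.
by apply: eq_bigr => i _; rewrite reimB.
Qed.

End GateauxDerivatives.

(** The maximum with 0 makes the constant nonnegative and covers empty families, whose supremum is
    [-oo]. *)
Lemma ereal_sup2_bounded {R : realType} {S T : Type} (X : set S) (Y : set T)
    (f : S -> T -> R) :
  (ereal_sup [set ereal_sup [set (f s t)%:E | t in Y] | s in X] < +oo)%E ->
  exists2 K, 0 <= K & forall s t, X s -> Y t -> f s t <= K.
Proof.
set M := ereal_sup _ => Moo; exists (Num.max 0 (fine M)).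
  by rewrite le_max lexx.
move=> s t Xs Yt; have : ((f s t)%:E <= M)%E.
  apply: (@le_trans _ _ (ereal_sup [set (f s t)%:E | t in Y])).
    by apply: ereal_sup_ubound; exists t.
  by apply: ereal_sup_ubound; exists s.
by case: M Moo => // r _; rewrite lee_fin le_max => ->; rewrite orbT.
Qed.

(** * Consequences of the RIP for secants and for derivatives of [phi] *)

Section SecantCone.
Context {R : realType} {D : completeNormedModType R[i]} {d m : nat}.
Context {H : completeNormedModType R}.
Variables (Sigma : set (dual D)) (emb : dual D -> H).
Variable A : {linear dual D -> 'rV[R[i]]_m}.
Variables (gamma : R) (phi : 'rV[R]_d -> dual D).
Hypothesis coneS : cone Sigma.
Hypothesis contA : continuous A.
Hypothesis gamma0 : 0 <= gamma.
Hypothesis ripA : rip A (secant Sigma) emb gamma.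

Lemma cnorm2_ge0 (z : 'rV[R[i]]_m) : 0 <= cnorm2 z.
Proof. exact: sqrtr_ge0. Qed.

Lemma cnorm2N (z : 'rV[R[i]]_m) : cnorm2 (- z) = cnorm2 z.
Proof.
rewrite /cnorm2; congr Num.sqrt; apply: eq_bigr => i _.
by rewrite mxE !raddfN !sqrrN.
Qed.

Lemma cnorm2D (z w : 'rV[R[i]]_m) : cnorm2 (z + w) <= cnorm2 z + cnorm2 w.
Proof.
rewrite -!l2norm_reim.
have -> : reim (z + w) = fun i => reim z i + reim w i.
  by apply/funext => i; exact: reimD.
exact: l2normD.
Qed.

Lemma rip_upper x y : Sigma x -> Sigma y ->
  cnorm2 (A x - A y) <= Num.sqrt (1 + gamma) * `|emb (x - y)|.
Proof.
move=> Sx Sy; have [|_] := ripA (x := x - y); first by exists x, y.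
rewrite linearB => h.
have g1 : 0 <= 1 + gamma by rewrite addr_ge0.
rewrite -ler_sqr ?nnegrE ?mulr_ge0 ?sqrtr_ge0 ?normr_ge0 ?cnorm2_ge0 //.
by rewrite exprMn (sqr_sqrtr g1).
Qed.

Hypothesis openT : open (phi @^-1` Sigma).
Hypothesis dphi : gateaux_differentiable phi.
Hypothesis compat : compatible Sigma emb phi.

(* The difference quotients of [phi] are secants because [Sigma] is a cone. *)
Lemma rip_gateaux_lower x u : Sigma (phi x) ->
  (1 - gamma) * gateaux_hnorm emb phi u x ^+ 2 <= cnorm2 (A (gateaux phi u x)) ^+ 2.
Proof.
move=> Sx; have hn := getPex (compat u Sx).
(* All limits are taken along the positive sequence [harmonic], on which the absolute values in
   [is_gateaux_hnorm] disappear. *)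
have h0 n : 0 < harmonic n :> R by rewrite harmonic_gt0.
have hE : (fun n => `|harmonic n : R|) = harmonic.
  by apply/funext => n; rewrite ger0_norm // ltW.
have harm0 : harmonic n @[n --> \oo] --> (0 : R) by exact: cvg_harmonic.
have := hn harmonic (fun n => lt0r_neq0 (h0 n)); rewrite hE => /(_ harm0).
under eq_fun do rewrite ger0_norm ?(ltW (h0 _)) //.
rewrite -/(gateaux_hnorm emb phi u x) => lim1.
have lim2 i : reim (A (diff_quotient phi x u (harmonic n))) i @[n --> \oo] -->
    reim (A (gateaux phi u x)) i.
  have : reim (A (diff_quotient phi x u h)) i @[h --> 0^'] -->
      reim (A (gateaux phi u x)) i.
    by apply: (measurement_cvg contA); exact: gateaux_cvg.
  by move=> /cvg_dnbhs_at_right/cvg_at_rightP; apply.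
have lim3 : cnorm2 (A (diff_quotient phi x u (harmonic n))) ^+ 2 @[n --> \oo] -->
    cnorm2 (A (gateaux phi u x)) ^+ 2.
  under eq_fun do rewrite -l2norm_reim sqr_l2norm.
  rewrite -l2norm_reim sqr_l2norm.
  by apply: cvg_big => [|i _]; [exact: add_continuous|exact: cvgM].
have lim4 : (1 - gamma) * `|emb (diff_quotient phi x u (harmonic n))| ^+ 2
    @[n --> \oo] --> (1 - gamma) * gateaux_hnorm emb phi u x ^+ 2.
  by apply: cvgM; [exact: cvg_cst|apply: cvgM].
apply: (ler_cvg_to lim4 lim3).
have near_x : x + harmonic n *: u @[n --> \oo] --> x.
  rewrite -[X in _ --> X]addr0 -(scale0r u).
  by apply: cvgD; [exact: cvg_cst|exact: cvgZr_tmp].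
(* Openness of the preimage puts [x + harmonic n *: u] in it for large [n], so the RIP holds for
   these quotients and passes to the limit. *)
have [N _ hN] := near_x _ (open_nbhs_nbhs (conj openT Sx)).
exists N => // n /hN Sn /=.
have [|//] := ripA (x := diff_quotient phi x u (harmonic n)).
have hC : 0 < (harmonic n : R)^-1 by rewrite invr_gt0.
exists (((harmonic n)^-1)%:C%C *: phi (x + harmonic n *: u)),
       (((harmonic n)^-1)%:C%C *: phi x).
by split; [exact: coneS|exact: coneS|rewrite -scalerBr].
Qed.

End SecantCone.

(** * Distance to the fiber of [thetas] *)

Section FiberDistance.
Context {R : realType} {D : completeNormedModType R[i]} {d : nat}.
Variables (Sigma : set (dual D)) (phi : 'rV[R]_d -> dual D) (thetas : 'rV[R]_d).

Lemma fiber_dist_le x t : fiber Sigma phi thetas t ->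
  fiber_dist Sigma phi x thetas <= norm2 (t - x).
Proof.
move=> Tt; apply: ge_inf; last by exists t.
by exists 0 => _ [s _ <-]; exact: norm2_ge0.
Qed.

Lemma fiber_dist_lt r x : within_dist (fiber Sigma phi thetas) r x ->
  fiber_dist Sigma phi x thetas < r.
Proof. by move=> [t Tt]; exact: le_lt_trans (fiber_dist_le x Tt). Qed.

Lemma fiber_projE x t : fiber_proj Sigma phi x thetas t ->
  norm2 (t - x) = fiber_dist Sigma phi x thetas.
Proof.
move=> [Tt tmin]; apply/eqP; rewrite eq_le fiber_dist_le // andbT.
by apply: lb_le_inf => [|_ [s Ts <-]]; [exists (norm2 (t - x)), t|exact: tmin].
Qed.

End FiberDistance.

Theorem theorem2p1 (R : realType) (D : completeNormedModType R[i])
    (H : completeNormedModType R) (ip : {dot H for idfun}) (d m : nat)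
    (Sigma : set (dual D)) (emb : dual D -> H)
    (alpha : 'I_m -> D) (A : {linear dual D -> 'rV[R[i]]_m})
    (gamma : R) (phi : 'rV[R]_d -> dual D)
    (x0 : dual D) (e : 'rV[R[i]]_m) (thetas : 'rV[R]_d) (beta C : R) :
  cone Sigma ->
  hilbert_norm ip ->
  contained_in_hilbert Sigma emb ->
  (forall x l, A x 0 l = x (alpha l)) ->
  continuous A ->
  0 <= gamma ->
  rip A (secant Sigma) emb gamma ->
  Sigma `<=` range phi ->
  continuous phi ->
  twice_gateaux_differentiable phi ->
  open (phi @^-1` Sigma) ->
  compatible Sigma emb phi ->
  Sigma x0 ->
  let g := residual A phi (A x0 + e) in
  global_minimizer g (phi @^-1` Sigma) thetas ->
  0 < beta ->
  technical_assumption Sigma phi A thetas beta emb C ->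
  (forall theta, Lambda Sigma phi thetas beta theta ->
    exists2 t, fiber_proj Sigma phi theta thetas t &
      forall z, line_segment theta t z ->
        ((C * beta + (Num.sqrt (1 + gamma))^-1 * cnorm2 e)%:E <=
         quotient_oo
           ((1 - gamma) * gateaux_hnorm emb phi (t - theta) z ^+ 2)
           (Num.sqrt (1 + gamma) *
            cnorm2 (A (gateaux (gateaux phi (t - theta)) (t - theta) z))))%E) ->
  basin_of_attraction g thetas (Lambda Sigma phi thetas beta).
Proof.
move=> coneS _ _ _ contA gamma0 ripA Sphi _ [dphi d2phi] openT compat Sx0 g
  [Sth thmin] beta0 [tech1 [C0 tech2] tech3 tech4] curv.
pose T := fiber Sigma phi thetas.
pose fd x := fiber_dist Sigma phi x thetas.
pose y := A x0 + e.
pose F := measurement A phi.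
pose G u := measurement A (gateaux phi u).
pose S u v := measurement A (gateaux (gateaux phi u) v).
pose q := Num.sqrt (1 + gamma).
have q0 : 0 < q by rewrite sqrtr_gt0 ltr_wpDr.
have gE : g = cost F (reim y) by exact: residual_cost.
have misfitE x : l2norm (misfit F (reim y) x) = cnorm2 (A (phi x) - y).
  rewrite -l2norm_reim; congr l2norm.
  by apply/funext => i; rewrite reimB.
have Tth : T thetas by [].
have gT t : T t -> g t = g thetas by move=> [_ e1]; rewrite /g /residual e1.
(* A parameter [th0] of [x0] is admissible and has misfit norm [cnorm2 e]; minimality of [thetas]
   compares the two. *)
have noise : cnorm2 (A (phi thetas) - y) <= cnorm2 e.
  have [th0 _ th0E] := Sphi _ Sx0.
  have := thmin th0; rewrite /= th0E => /(_ Sx0); rewrite /g /residual th0E.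
  rewrite opprD addNKr cnorm2N.
  by rewrite ler_sqr ?nnegrE ?cnorm2_ge0.
(* The RIP and the Lipschitz bound control [A (phi x) - A (phi thetas)], and [noise] the rest. *)
have misfit_le x : fd x < 2 * beta ->
    l2norm (misfit F (reim y) x) <= q * (C * fd x) + cnorm2 e.
  move=> xb; have Sx := tech1 _ xb; rewrite misfitE.
  rewrite -(subrKA (A (phi thetas))); apply: le_trans (cnorm2D _ _) _.
  apply: lerD => //; apply: le_trans (rip_upper gamma0 ripA Sx Sth) _.
  by rewrite ler_wpM2l ?(ltW q0) //; exact: tech2.
have [K1 K10 hK1] := ereal_sup2_bounded tech3.
have [K2 K20 hK2] := ereal_sup2_bounded
  (f := fun x uv => cnorm2 (A (gateaux (gateaux phi uv.1) uv.2 x))) tech4.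
have linG x u v a i : G (a *: u + v) x i = a * G u x i + G v x i.
  exact: measurement_gateaux_linear.
have normG x w a : l2norm (G (a *: w) x) = `|a| * l2norm (G w x).
  rewrite -l2normZ; congr l2norm; apply/funext => i.
  by have := linG x w 0 a i; rewrite addr0 => ->; rewrite (G0 linG) addr0.
have normS x w z a b :
    l2norm (S (a *: w) (b *: z) x) = `|a * b| * l2norm (S w z x).
  rewrite -l2normZ; congr l2norm; apply/funext => i.
  exact: (measurement_gateaux2Z contA x w z a b i (conj dphi d2phi)).
have boundG t u : T t -> l2norm (G u t) <= K1 * norm2 u.
  move=> [_ phit]; have [w uE u01] := norm2_unit u.
  rewrite {1}uE normG ger0_norm ?norm2_ge0 // mulrC.
  case: u01 => [->|w1]; first by rewrite !mulr0.
  rewrite ler_wpM2r ?norm2_ge0 // [l2norm _]l2norm_reim.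
  exact: (hK1 _ _ phit w1).
have boundS x u v : within_dist T (2 * beta) x ->
    l2norm (S u v x) <= K2 * norm2 u * norm2 v.
  move=> /fiber_dist_lt xb; have Lx : Lambda Sigma phi thetas (2 * beta) x.
    by split => //; exact: tech1.
  have [w uE u01] := norm2_unit u; have [z vE v01] := norm2_unit v.
  rewrite {1}uE {1}vE normS ger0_norm ?mulr_ge0 ?norm2_ge0 // mulrC -[K2 * _ * _]mulrA.
  case: u01 => [->|w1]; first by rewrite !(mul0r, mulr0).
  case: v01 => [->|z1]; first by rewrite !mulr0.
  rewrite ler_wpM2r ?mulr_ge0 ?norm2_ge0 // [l2norm _]l2norm_reim.
  exact: (hK2 x (w, z) Lx (conj w1 z1)).
have boundF x : within_dist T (2 * beta) x ->
    l2norm (misfit F (reim y) x) <= q * (C * (2 * beta)) + cnorm2 e.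
  move=> /fiber_dist_lt xb; apply: le_trans (misfit_le _ xb) _.
  by rewrite lerD2r ler_wpM2l ?(ltW q0) // ler_wpM2l ?(ltW C0) // ltW.
have B0 : 0 <= q * (C * (2 * beta)) + cnorm2 e.
  by rewrite addr_ge0 ?cnorm2_ge0 // mulr_ge0 ?(ltW q0) // !mulr_ge0 // ltW.
have gmin_le x : within_dist T (2 * beta) x -> g thetas <= cost F (reim y) x.
  by move=> /fiber_dist_lt /tech1 Sx; rewrite -gE; exact: thmin.
have derF x u i : is_derive x u (F ^~ i) (G u x i).
  exact: is_derive_measurement.
have derG x u v i : is_derive x v (G u ^~ i) (S u v x i).
  exact: is_derive_measurement.
(* The projection supplied by [curv] attains the infimum, hence is a witness for [within_dist]. *)
have near_Lambda x : Lambda Sigma phi thetas beta x -> within_dist T beta x.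
  move=> Lx; have [t tx _] := curv x Lx; have [Tt _] := tx.
  by exists t => //; rewrite (fiber_projE tx); case: Lx.
have Lambda_near x : within_dist T beta x -> Lambda Sigma phi thetas beta x.
  move=> /fiber_dist_lt xb; split => //; apply: tech1.
  by apply: lt_trans xb _; rewrite mulr_natl mulr2n ltrDl.
split.
  apply: Lambda_near; exists thetas => //.
  by rewrite subrr -(scale0r 0) norm2Z normr0 mul0r.
have [x Tx|tau0 tau00 conv] := gradient_descent_least_squares derF derG linG
    beta0 K10 K20 B0 boundG boundS boundF gmin_le; last first.
  exists tau0 => // tau x ht htau /near_Lambda/(conv _ _ ht htau).
  by rewrite -gE.
have Lx := Lambda_near _ Tx; have [t tx hz] := curv x Lx.
exists t; split; [exact: tx|by rewrite -gE gT //; case: tx|].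
move=> s /andP[s0 s1]; set u := t - x; set z := x + s *: u.
have zseg : line_segment x t z.
  exists s; first by rewrite /= in_itv /= s0.
  by rewrite /z /u scalerBl scale1r scalerBr addrAC addrA.
(* The distance from [z] to [t] is [1 - s] times that from [x], so the bounds on the misfit and the
   RIP are available on the whole segment. *)
have zb : fd z < beta.
  apply: fiber_dist_lt; exists t; first by case: tx.
  have -> : t - z = (1 - s) *: u by rewrite /z opprD addrA scalerBl scale1r.
  rewrite norm2Z ger0_norm ?subr_ge0 //.
  apply: le_lt_trans (_ : norm2 u < beta).
    by rewrite ler_piMl ?norm2_ge0 // gerBl.
  by rewrite (fiber_projE tx); case: Lx.
have zb2 : fd z < 2 * beta.
  by apply: lt_trans zb _; rewrite mulr_natl mulr2n ltrDl.
have := rip_gateaux_lower coneS contA ripA openT dphi compat u (tech1 _ zb2).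
rewrite -l2norm_reim sqr_l2norm -/(G u z).
have := hz z zseg; rewrite -/u.
have -> : cnorm2 (A (gateaux (gateaux phi u) u z)) = l2norm (S u u z).
  by rewrite -l2norm_reim.
set a := (1 - gamma) * _; set p := l2norm _ => hq aG.
have mz : l2norm (misfit F (reim y) z) <= q * (C * beta) + cnorm2 e.
  apply: le_trans (misfit_le _ zb2) _.
  by rewrite lerD2r ler_wpM2l ?(ltW q0) // ler_wpM2l ?(ltW C0) // ltW.
(* Multiplying [curv] by the denominator [q * p] turns its right side into [p] times the misfit
   bound [mz]; if [p] is zero the claim is trivial. *)
have pa : p * (q * (C * beta) + cnorm2 e) <= inner (G u z) (G u z).
  have [->|p0] := eqVneq p 0; first by rewrite mul0r inner_ge0.
  apply: le_trans aG; move: hq; rewrite /quotient_oo mulf_eq0 (negPf p0).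
  rewrite (gt_eqF q0) /= lee_fin ler_pdivlMr; last first.
    by rewrite mulr_gt0 // lt_def p0 l2norm_ge0.
  apply: le_trans; rewrite le_eqVlt; apply/orP; left; apply/eqP.
  by rewrite -/q; field; rewrite gt_eqF.
(* By Cauchy-Schwarz, [mz] and [pa], the possibly negative [S] term is dominated by
   [inner (G u z) (G u z)]. *)
have := normr_inner_le (S u u z) (misfit F (reim y) z).
have : p * l2norm (misfit F (reim y) z) <= p * (q * (C * beta) + cnorm2 e).
  by rewrite ler_wpM2l ?l2norm_ge0.
rewrite ler_norml -/p => h1 /andP[h2 _]; move: h1 h2 pa; lra.
Qed.
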